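(* In the edge-distinguishing game (EDGe) played on the cycle $C_4$ (with $\lambda(C_4)$ colors), Player 2 has a winning strategy.
   Context: $C_n$ is the cycle on $n$ vertices. For a positive integer $k$ let $[k]=\{1,\dots,k\}$. A $k$-coloring $c:V(G)\to[k]$ induces $c'(\{u,v\})=\{c(u),c(v)\}$ (a multiset); $c$ is edge-distinguishing if $c'$ is injective, and $\lambda(G)$ is the least $k$ admitting such a coloring. A partial coloring on $U\subseteq V(G)$ has partial induced edge coloring on $G[U]$. EDGe on $G$: two players, Player 1 first, alternately color an uncolored vertex with a color from $[\lambda(G)]$; a move is legal iff afterwards the partial induced edge coloring of the colored vertices is injective. The player making the last legal move wins. A winning strategy guarantees a win regardless of the opponent's play. *)

(* Defs.v *)
From mathcomp Require Import all_boot.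
From mathcomp Require Import finmap multiset.

Set Implicit Arguments.
Unset Strict Implicit.
Unset Printing Implicit Defensive.

Local Open Scope mset_scope.

Record sgraph := SGraph {
  vertex :> finType;
  adj : rel vertex;
  adj_sym : symmetric adj;
  adj_irr : irreflexive adj }.

Definition edges (G : sgraph) : {set {set G}} :=
  [set [set p.1; p.2] | p : G * G & adj p.1 p.2].

(* The edge set of the induced subgraph G[U]. *)
Definition induced_edges (G : sgraph) (U : {set G}) : {set {set G}} :=
  [set e in edges G | e \subset U].

Definition cycle_rel (n : nat) : rel 'I_n :=
  [rel i j | (i != j) && ((j == ordS i) || (i == ordS j))].

Lemma cycle_rel_sym n : symmetric (@cycle_rel n).
Proof. by move=> i j; rewrite /cycle_rel /= eq_sym orbC. Qed.

Lemma cycle_rel_irr n : irreflexive (@cycle_rel n).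
Proof. by move=> i; rewrite /cycle_rel /= eqxx. Qed.

(* This is the cycle on n vertices only for n >= 3. *)
Definition cycle_graph (n : nat) : sgraph :=
  SGraph (@cycle_rel_sym n) (@cycle_rel_irr n).

(* The k colors are the elements 0, ..., k-1 of 'I_k. *)
Definition edge_color (G : sgraph) (k : nat) (c : G -> 'I_k) (e : {set G}) :
  {mset 'I_k} := seq_mset [seq c x | x <- enum e].

Definition edge_distinguishing (G : sgraph) (k : nat) (c : G -> 'I_k) : bool :=
  dinjectiveb (edge_color c) (edges G).

Definition ed_colorable (G : sgraph) (k : nat) : bool :=
  (0 < k) && [exists c : {ffun G -> 'I_k}, edge_distinguishing c].

Lemma ed_colorable_ex (G : sgraph) : exists k, ed_colorable G k.
Proof.
exists #|G|.+1; apply/andP; split => //; apply/existsP.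
pose f (x : G) : 'I_#|G|.+1 := widen_ord (leqnSn _) (enum_rank x).
have f_inj : injective f.
  by move=> x y /(congr1 val) /= /val_inj; apply: enum_rank_inj.
exists (finfun f); apply/dinjectiveP => e e' _ _ /eq_seq_msetP Hp.
apply/setP => x.
have fi : injective (finfun f) by move=> a b; rewrite !ffunE; apply: f_inj.
by have := perm_mem Hp (finfun f x); rewrite !(mem_map fi) !mem_enum.
Qed.

Definition lambda (G : sgraph) : nat := ex_minn (ed_colorable_ex G).

(* [None] marks an uncolored vertex. *)
Definition pcoloring (G : sgraph) (k : nat) := {ffun G -> option 'I_k}.

Definition colored (G : sgraph) (k : nat) (c : pcoloring G k) : {set G} :=
  [set x | c x != None].

(* For an edge inside [colored c], [pmap] drops nothing, so this is the multiset
   of the two colors of its ends. *)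
Definition partial_edge_color (G : sgraph) (k : nat) (c : pcoloring G k)
  (e : {set G}) : {mset 'I_k} := seq_mset (pmap c (enum e)).

Definition partial_edge_distinguishing (G : sgraph) (k : nat)
  (c : pcoloring G k) : bool :=
  dinjectiveb (partial_edge_color c) (induced_edges (colored c)).

Definition move (G : sgraph) : Type := (G * 'I_(lambda G))%type.

Definition position (G : sgraph) := pcoloring G (lambda G).

Definition start (G : sgraph) : position G := [ffun => None].

Definition do_move (G : sgraph) (c : position G) (m : move G) : position G :=
  [ffun x => if x == m.1 then Some m.2 else c x].

Definition legal (G : sgraph) (c : position G) (m : move G) : bool :=
  (c m.1 == None) && partial_edge_distinguishing (do_move c m).

(* A play is the sequence of moves made so far, in chronological order. *)
Definition position_after (G : sgraph) (s : seq (move G)) : position G :=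
  foldl (@do_move G) (start G) s.

Definition legal_play (G : sgraph) (s : seq (move G)) : Prop :=
  forall (s1 s2 : seq (move G)) (m : move G),
    s = s1 ++ m :: s2 -> legal (position_after s1) m.

Definition game_over (G : sgraph) (s : seq (move G)) : Prop :=
  forall m : move G, ~~ legal (position_after s) m.

Inductive player := Player1 | Player2.

(* The player making the move with index i, counted from 0. *)
Definition mover (i : nat) : player := if odd i then Player2 else Player1.

Definition wins (G : sgraph) (p : player) (s : seq (move G)) : Prop :=
  [/\ 0 < size s, game_over s & mover (size s).-1 = p].

Definition strategy (G : sgraph) : Type := seq (move G) -> move G.

Definition follows (G : sgraph) (p : player) (sigma : strategy G)
  (s : seq (move G)) : Prop :=
  forall (s1 s2 : seq (move G)) (m : move G),
    s = s1 ++ m :: s2 -> mover (size s1) = p -> m = sigma s1.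

(* The first clause is needed because [strategy] is total: it forbids sigma to
   answer with an illegal move while a legal one exists, which would make the
   second clause vacuous. *)
Definition winning_strategy (G : sgraph) (p : player) (sigma : strategy G) :
  Prop :=
  (forall s : seq (move G), legal_play s -> follows p sigma s ->
     mover (size s) = p -> ~ game_over s -> legal (position_after s) (sigma s))
  /\
  (forall s : seq (move G), legal_play s -> follows p sigma s ->
     game_over s -> wins p s).

Definition has_winning_strategy (G : sgraph) (p : player) : Prop :=
  exists sigma : strategy G, winning_strategy p sigma.

(* Main.v *)
Require Import Defs.
From mathcomp Require Import all_boot.
From mathcomp Require Import finmap multiset.

(** Player 2 answers the first move by giving the same color to the opposite
    vertex. This is legal because no edge has both ends colored, and it ends the
    game: each remaining vertex is adjacent to both colored ones, so coloring it
    would create two edges of the same color. *)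

Lemma lambda_gt0 (G : sgraph) : 0 < lambda G.
Proof. by rewrite /lambda; case: ex_minnP => k /andP[]. Qed.

Lemma induced_edges_pair (G : sgraph) (U : {set G}) (x y : G) :
  adj x y -> x \in U -> y \in U -> [set x; y] \in induced_edges U.
Proof.
move=> xy xU yU; rewrite inE subUset !sub1set xU yU !andbT.
by apply/imsetP; exists (x, y); rewrite ?inE.
Qed.

(** An independent set of colored vertices induces no edge, so injectivity is vacuous. *)
Lemma stable_partial_edge_distinguishing (G : sgraph) (k : nat)
    (c : pcoloring G k) :
  (forall x y, x \in colored c -> y \in colored c -> ~~ adj x y) ->
  partial_edge_distinguishing c.
Proof.
move=> stable; apply/dinjectiveP => e e'; rewrite inE => /andP[/imsetP[[x y]]].
rewrite inE /= => xy ->; rewrite subUset !sub1set => /andP[xc yc].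
by have := stable _ _ xc yc; rewrite xy.
Qed.

Lemma partial_edge_color_pair (G : sgraph) (k : nat) (c : pcoloring G k)
    (x y : G) (a b : 'I_k) :
  x != y -> c x = Some a -> c y = Some b ->
  partial_edge_color c [set x; y] = seq_mset [:: a; b].
Proof.
move=> xy cx cy; apply/eq_seq_msetP.
(* The order in which [enum] lists the pair is unknown, but multisets only see lists up to
   permutation. *)
have -> : [:: a; b] = pmap c [:: x; y] by rewrite /= cx cy.
apply: perm_pmap; apply: uniq_perm; rewrite ?enum_uniq //= ?inE ?xy //.
by move=> z; rewrite mem_enum !inE.
Qed.

(** Whatever [b] is, the edges from [x] to [y] and to [z] would both receive the multiset of [a] and
    [b]; they are distinct since [y] lies only on the first. *)
Lemma common_neighbor_illegal (G : sgraph) (c : position G) (x y z : G)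
    (a b : 'I_(lambda G)) :
  adj x y -> adj x z -> y != z -> c y = Some a -> c z = Some a ->
  ~~ legal c (x, b).
Proof.
move=> xy xz yz cy cz; apply/negP => /andP[_ /dinjectiveP inj].
have nxy : x != y by apply: contraTneq xy => ->; rewrite adj_irr.
have nxz : x != z by apply: contraTneq xz => ->; rewrite adj_irr.
set c' := do_move c (x, b) in inj.
have c'x : c' x = Some b by rewrite ffunE eqxx.
have c'y : c' y = Some a by rewrite ffunE eq_sym (negbTE nxy).
have c'z : c' z = Some a by rewrite ffunE eq_sym (negbTE nxz).
have /setP/(_ y) : [set x; y] = [set x; z].
  apply: inj; try by apply: induced_edges_pair; rewrite // inE ?c'x ?c'y ?c'z.
  by rewrite (partial_edge_color_pair _ _ c' _ _ b a)
             ?(partial_edge_color_pair _ _ c' _ _ b a).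
by rewrite !inE eqxx orbT eq_sym (negbTE nxy) (negbTE yz).
Qed.

Lemma first_move_legal (G : sgraph) (m : move G) : legal (start G) m.
Proof.
rewrite /legal ffunE eqxx; apply: stable_partial_edge_distinguishing => x y.
rewrite !inE !ffunE; case: (x =P m.1) => // ->.
by case: (y =P m.1) => // ->; rewrite adj_irr.
Qed.

Definition opposite (v : cycle_graph 4) : cycle_graph 4 :=
  ordS (ordS (v : 'I_4)).

Lemma opposite_neq v : opposite v != v.
Proof. by case: v => [[|[|[|[|]]]]]. Qed.

Lemma opposite_nadj v : ~~ adj v (opposite v).
Proof. by case: v => [[|[|[|[|]]]]]. Qed.

(** This is where length 4 matters: the two vertices outside an opposite pair are common neighbors
    of it. *)
Lemma adj_opposite (v x : cycle_graph 4) :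
  x != v -> x != opposite v -> adj x v && adj x (opposite v).
Proof. by case: v => [[|[|[|[|]]]]] // ?; case: x => [[|[|[|[|]]]]]. Qed.

Definition mirror (m : move (cycle_graph 4)) : move (cycle_graph 4) :=
  (opposite m.1, m.2).

Lemma mirror_legal m : legal (position_after [:: m]) (mirror m).
Proof.
rewrite /legal /= !ffunE (negbTE (opposite_neq _)) eqxx.
apply: stable_partial_edge_distinguishing => x y.
have coloredE z : z \in colored (do_move (position_after [:: m]) (mirror m)) ->
    z = opposite m.1 \/ z = m.1.
  rewrite inE !ffunE; case: (z =P opposite m.1) => [->|_]; first by left.
  by case: (z =P m.1) => [->|_]; first by right.
case/coloredE=> -> /coloredE[]->; rewrite ?adj_irr ?opposite_nadj //.
by rewrite adj_sym opposite_nadj.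
Qed.

Lemma mirror_game_over m : game_over [:: m; mirror m].
Proof.
move=> [x b]; set c := position_after _.
have cm : c m.1 = Some m.2.
  by rewrite !ffunE /= eq_sym (negbTE (opposite_neq _)) eqxx.
have co : c (opposite m.1) = Some m.2 by rewrite !ffunE eqxx.
have [->|xm] := eqVneq x m.1; first by rewrite /legal cm.
have [->|xo] := eqVneq x (opposite m.1); first by rewrite /legal co.
have /andP[adjm adjo] := adj_opposite _ _ xm xo.
by apply: common_neighbor_illegal adjm adjo _ cm co; rewrite eq_sym opposite_neq.
Qed.

Theorem theorem3p13 : has_winning_strategy (cycle_graph 4) Player2.
Proof.
(* As the default of [head], [m0] only serves the empty play, where Player 2 is not to move. It also
   witnesses below that the game is not over at the start. *)
pose m0 : move (cycle_graph 4) := (ord0, Ordinal (lambda_gt0 _)).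
pose sigma : strategy (cycle_graph 4) := fun s => mirror (head m0 s).
(* Once the second move is the mirrored one, no third move is legal, so only plays of at most two
   moves remain. *)
have short m m' m'' s : legal_play [:: m, m', m'' & s] ->
    follows Player2 sigma [:: m, m', m'' & s] -> False.
  move=> leg fol; have := leg [:: m; m'] s m'' erefl.
  by rewrite (fol [:: m] _ m' erefl erefl) (negbTE (mirror_game_over m _)).
(* Both clauses are checked by the length of the play. In the first, lengths 0 and 2 are trivial
   because Player 1 is to move; in the second, length 2 is trivial because Player 2 moved last. *)
exists sigma; split=> -[|m [|m' [|m'' s]]] // leg fol.
- by move=> _ _; apply: mirror_legal.
- by case: (short _ _ _ _ leg fol).
- by move=> /(_ m0); rewrite first_move_legal.
- by move=> /(_ (mirror m)); rewrite mirror_legal.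
- by case: (short _ _ _ _ leg fol).
Qed.
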